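(* Let $G$ be a minimally $2$-connected graph of size $m$, and let $\alpha\in[\frac{1}{2},1)$. (i) If $m\geq 6$ is an even number, then $\rho_{\alpha}(G)\leq\rho_{\alpha}(K_{2,\frac{m}{2}})$, with equality if and only if $G\cong K_{2,\frac{m}{2}}$. (ii) If $m\geq 9$ is an odd number, then $\rho_{\alpha}(G)\leq\rho_{\alpha}(SK_{2,\frac{m-1}{2}})$, where $\rho_{\alpha}(SK_{2,\frac{m-1}{2}})$ is the largest root of $$x^3-\left(\frac{m+5}{2}\alpha+1\right)x^2+\left(\frac{m+5}{2}\alpha^2+\frac{5(m-1)}{2}\alpha+2-m\right)x-2m\alpha^2-(m-5)\alpha+m-3=0,$$ with equality $\rho_{\alpha}(G)=\rho_{\alpha}(SK_{2,\frac{m-1}{2}})$ if and only if $G\cong SK_{2,\frac{m-1}{2}}$.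
   Context: All graphs are finite, simple and undirected. The size of a graph is its number of edges. For a graph $G$, let $A(G)$ be its adjacency matrix and $D(G)$ the diagonal matrix of its vertex degrees. For real $\alpha\in[0,1]$, define $A_\alpha(G)=\alpha D(G)+(1-\alpha)A(G)$; its largest eigenvalue is denoted $\rho_\alpha(G)$ (the $\alpha$-index, or $A_\alpha$-spectral radius, of $G$). A graph is $k$-connected if removing fewer than $k$ vertices always leaves the remaining graph connected. A graph is minimally $k$-connected if it is $k$-connected and deleting any arbitrarily chosen edge always leaves a graph that is not $k$-connected. $K_{s,t}$ denotes the complete bipartite graph with parts of sizes $s$ and $t$. For an odd number $m$, $SK_{2,\frac{m-1}{2}}$ denotes the graph obtained from $K_{2,\frac{m-1}{2}}$ by subdividing one edge, i.e. replacing one edge $uv$ by a path $u,z,v$ through a new vertex $z$ (it has $m$ edges and $\frac{m+5}{2}$ vertices). *)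

(* Defs.v *)
From HB Require Import structures.
From mathcomp Require Import all_boot all_order all_algebra.
From mathcomp Require Import all_classical all_reals.

Set Implicit Arguments.
Unset Strict Implicit.
Unset Printing Implicit Defensive.

Import Order.TTheory GRing.Theory Num.Theory.

Local Open Scope ring_scope.

Record sgraph := SGraph {
  vertex :> finType;
  adj : rel vertex;
  adj_sym : symmetric adj;
  adj_irr : irreflexive adj }.

Notation "x -- y" := (adj x y) (at level 30).

Definition edges (G : sgraph) : {set {set G}} :=
  [set [set p.1; p.2] | p : G * G & p.1 -- p.2].

Definition gsize (G : sgraph) : nat := #|edges G|.

Definition deg (G : sgraph) (x : G) : nat := #|[set y | x -- y]|.

Definition giso (G H : sgraph) : Prop :=
  exists2 f : G -> H, bijective f & forall x y : G, (f x -- f y) = (x -- y).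

Definition gconnected (G : sgraph) : Prop :=
  forall x y : G, connect (@adj G) x y.

Section Induced.
Variables (G : sgraph) (S : {set G}).
Definition induced_adj (x y : {x : G | x \in S}) : bool := val x -- val y.
Lemma induced_sym : symmetric induced_adj.
Proof. by move=> x y; rewrite /induced_adj adj_sym. Qed.
Lemma induced_irr : irreflexive induced_adj.
Proof. by move=> x; rewrite /induced_adj adj_irr. Qed.
Definition induced : sgraph := SGraph induced_sym induced_irr.
End Induced.

Section DeleteEdge.
Variables (G : sgraph) (u v : G).
Definition del_adj (x y : G) : bool :=
  (x -- y) && ([set x; y] != [set u; v] :> {set G}).
Lemma del_sym : symmetric del_adj.
Proof. by move=> x y; rewrite /del_adj adj_sym finset.setUC. Qed.
Lemma del_irr : irreflexive del_adj.
Proof. by move=> x; rewrite /del_adj adj_irr. Qed.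
Definition del_edge : sgraph := SGraph del_sym del_irr.
End DeleteEdge.

(* No lower bound on the order of [G] is imposed, so the complete graphs on at
   most [k] vertices count as [k.-connected]; the empty graph is connected. *)
Definition kconnected (k : nat) (G : sgraph) : Prop :=
  forall S : {set G}, (#|S| < k)%N -> gconnected (induced (finset.setC S)).

Definition minimally_kconnected (k : nat) (G : sgraph) : Prop :=
  kconnected k G /\
  forall u v : G, u -- v -> ~ kconnected k (del_edge u v).

Section CompleteBipartite.
Variables s t : nat.
Definition Kbip_adj (x y : 'I_s + 'I_t) : bool :=
  match x, y with
  | inl _, inr _ | inr _, inl _ => true
  | _, _ => false
  end.
Lemma Kbip_sym : symmetric Kbip_adj.
Proof. by move=> [x|x] [y|y]. Qed.
Lemma Kbip_irr : irreflexive Kbip_adj.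
Proof. by move=> [x|x]. Qed.
Definition Kbip : sgraph := SGraph Kbip_sym Kbip_irr.
End CompleteBipartite.

(* [None] is the new vertex of the path u, z, v replacing the edge uv. *)
Section Subdivide.
Variables (G : sgraph) (u v : G).
Definition subdiv_adj (x y : option G) : bool :=
  match x, y with
  | Some a, Some b => @adj (del_edge u v) a b
  | Some a, None | None, Some a => (a == u) || (a == v)
  | None, None => false
  end.
Lemma subdiv_sym : symmetric subdiv_adj.
Proof. by move=> [x|] [y|] //=; exact: del_sym. Qed.
Lemma subdiv_irr : irreflexive subdiv_adj.
Proof. by move=> [x|] //=; exact: del_irr. Qed.
Definition subdivide : sgraph := SGraph subdiv_sym subdiv_irr.
End Subdivide.

(* All edges of K_{2,t} are equivalent under automorphisms, so subdividing the
   edge between the first vertices of the two parts loses nothing. For [t = 0]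
   there is no edge, and the value is irrelevant. *)
Definition SK2 (t : nat) : sgraph :=
  match t with
  | 0 => Kbip 2 0
  | t'.+1 => @subdivide (Kbip 2 t'.+1) (inl ord0) (inr ord0)
  end.

Section AlphaIndex.
Variables (R : realType) (alpha : R) (G : sgraph).

Definition adj_mx : 'M[R]_#|G| :=
  \matrix_(i, j) (enum_val i -- enum_val j : bool)%:R.

Definition deg_mx : 'M[R]_#|G| := diag_mx (\row_i (deg (enum_val i))%:R).

Definition Aalpha : 'M[R]_#|G| := alpha *: deg_mx + (1 - alpha) *: adj_mx.

(* The spectrum is finite and, if [G] has a vertex, nonempty because [Aalpha]
   is real symmetric: this supremum is then the largest eigenvalue. *)
Definition rho : R := sup [set a : R | eigenvalue Aalpha a]%classic.

End AlphaIndex.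

Definition is_largest_root (R : realType) (p : {poly R}) (r : R) : Prop :=
  root p r /\ forall x : R, root p x -> x <= r.

(* Main.v *)
(* In a minimally 2-connected graph every edge becomes a bridge after the
   deletion of some vertex; hence, beyond order 3, there are no triangles, and
   the degree sum D(v) over the neighbours of v satisfies 2 d(v) <= D(v) <= m.
   If D(v) = m and d(v) >= 3, then G is K_{2,d(v)}.

   Any positive vector x with A_alpha x <= c x bounds rho_alpha by c, so no
   Perron-Frobenius theory is needed. With t = m / 2 rounded down, let r be the
   larger root of (x - alpha t)(x - 2 alpha) = (2t - 1)(1 - alpha)^2. The same
   equation with 2t in place of 2t - 1 has the root rho(K_{2,t}), and the cubic
   of the theorem is
     (x - alpha - 1)((x - alpha t)(x - 2 alpha) - (2t - 1)(1 - alpha)^2)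
       - (1 - alpha)^3,
   so both extremal values exceed r. All other graphs satisfy rho <= r: use the
   degree vector when the maximum degree is less than t; the only remaining
   graphs consist of a vertex of degree t whose neighbours have degree 2, and
   two adjacent hubs. *)
Require Import Defs.
From HB Require Import structures.
From mathcomp Require Import all_boot all_order all_algebra.
From mathcomp Require Import all_classical all_reals.
From mathcomp Require Import finset zify ring lra.

Set Implicit Arguments.
Unset Strict Implicit.
Unset Printing Implicit Defensive.

Import Order.TTheory GRing.Theory Num.Theory.
Local Open Scope ring_scope.

(** * Connectivity and separators *)

(** Walks of [G] minus [S] are kept on the vertices of [G] itself, so that later arguments need no
    subtype. *)
Definition avoid (G : sgraph) (S : {set G}) : rel G :=
  [rel x y | [&& x \notin S, y \notin S & x -- y]].

Lemma gconnected_avoid (G : sgraph) (S : {set G}) :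
  gconnected (induced (~: S)) <->
  forall x y, x \notin S -> y \notin S -> connect (avoid S) x y.
Proof.
split=> [conn x y xS yS | conn x y].
- have xS' : x \in ~: S by rewrite inE.
  have yS' : y \in ~: S by rewrite inE.
  have /connectP[p pp e] := conn (exist _ x xS') (exist _ y yS').
  have -> : y = val (last (exist _ x xS' : induced (~: S)) p) by rewrite -e.
  rewrite -[x in connect _ x]/(val (exist (fun z => z \in ~: S) x xS')).
  apply/connectP; exists (map val p); last by rewrite last_map.
  elim: p (exist _ x xS' : induced (~: S)) pp {e} => //= a p IH b /andP[ba /IH ->].
  rewrite andbT /avoid /= -!in_setC.
  by rewrite (valP a) (valP b).
- have : connect (avoid S) (val x) (val y).
    by apply: conn; rewrite -in_setC; [exact: (valP x)|exact: (valP y)].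
  case/connectP => p; elim: p x => [|a p IH] x /=.
    by move=> _ /val_inj ->.
  case/andP => /and3P[_ aS xa] pp ey.
  have aS' : a \in ~: S by rewrite inE.
  apply: (connect_trans (y := exist _ a aS' : induced (~: S))); last exact: IH.
  exact: connect1.
Qed.

(** Since [G - v] is connected, a set that no edge of [G - v] leaves is all of [G - v] once it meets
    it. Most structure results below exhibit such a closed set. *)
Lemma kconnected2_closed (G : sgraph) (v : G) (C : {set G}) (x y : G) :
  kconnected 2 G -> x \in C -> x != v -> y != v ->
  (forall a b, a \in C -> a != v -> b != v -> a -- b -> b \in C) -> y \in C.
Proof.
move=> conn xC xv yv clC.
have := conn [set v]; rewrite cards1 => /(_ isT) /gconnected_avoid /(_ x y).
rewrite !inE => /(_ xv yv) /connectP[p pp ->].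
elim: p x pp xC {xv} => //= a p IH x /andP[/and3P[xv av xa] pp] xC.
by apply: IH pp _; apply: clC xC _ _ xa; rewrite -in_set1.
Qed.

(* A chord of a cycle could be deleted, so some vertex [z] meets every other
   path from [u] to [v]; [C] is the component of [u] in [G - z - uv]. *)
Lemma minimally_2connected_separator (G : sgraph) (u v : G) :
  minimally_kconnected 2 G -> (2 < #|G|)%N -> u -- v ->
  exists z, exists C : {set G},
    [/\ z != u /\ z != v, u \in C, v \notin C, z \notin C &
     forall a b, a \in C -> b != z -> a -- b -> (a, b) != (u, v) -> b \in C].
Proof.
move=> [conn minG] n3 uv; apply: contrapT => nosep.
apply: (minG _ _ uv) => S cardS; apply/gconnected_avoid => x y xS yS.
have uNv : u != v by apply: contraTneq uv => ->; rewrite adj_irr.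
(* Only the edge [uv] is lost, so it suffices to find a detour from [u] to [v] off [S]. *)
have uvS : u \notin S -> v \notin S -> connect (@avoid (del_edge u v) S) u v.
  move=> uS vS.
  (* [S] has at most one element. If it is empty, a third vertex serves as [z]; this needs order at
     least 3. *)
  have [z [zu zv sub]] : exists z, [/\ z != u, z != v & S \subset [set z]].
    have [-> | [z zS]] := set_0Vmem S.
      have : (0 < #|~: [set u; v]|)%N.
        by rewrite cardsCs finset.setCK cards2 uNv subn_gt0.
      case/card_gt0P => z; rewrite !inE negb_or => /andP[zu zv].
      by exists z; rewrite sub0set.
    exists z; split; [by apply: contraNneq uS => <-|by apply: contraNneq vS => <-|].
    apply/fintype.subsetP => w wS; rewrite inE; apply: contraTT cardS => wz.
    rewrite -leqNgt -(_ : #|[set w; z]| = 2%N); last by rewrite cards2 wz.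
    by apply/subset_leq_card/fintype.subsetP => a; rewrite !inE => /orP[]/eqP->.
  pose e := @avoid (del_edge u v) [set z].
  have : connect e u v.
    apply: contrapT => /negP nuv; apply: nosep.
    exists z; exists [set w | connect e u w]; rewrite !inE connect0; split=> //.
      apply/negP => /connectP[p]; case/lastP: p => [|p a] /=.
        by move=> _ zu'; rewrite zu' eqxx in zu.
      rewrite rcons_path last_rcons => /andP[_ /and3P[_ + _]] za.
      by rewrite -za inE eqxx.
    move=> a b; rewrite !inE => ua bz ab abuv.
    apply: connect_trans (ua) (connect1 _).
    rewrite /e /avoid /= !inE bz /del_adj ab /=; apply/andP; split.
      apply: contraTneq ua => ->; apply/negP => /connectP[p].
      case/lastP: p => [|p c] /=; first by move=> _ zu'; rewrite zu' eqxx in zu.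
      rewrite rcons_path last_rcons => /andP[_ /and3P[_ + _]] zc.
      by rewrite -zc inE eqxx.
    (* If [ab] is the deleted edge, then either [(a, b) = (u, v)], which is excluded, or [a = v],
       which [e] does not reach from [u]. *)
    apply: contra abuv => /eqP E.
    have : a \in [set u; v] by rewrite -E !inE eqxx.
    have : b \in [set u; v] by rewrite -E !inE eqxx orbT.
    rewrite !inE => /orP[]/eqP eb /orP[]/eqP ea; subst => //.
    - by rewrite adj_irr in ab.
    - by rewrite ua in nuv.
    - by rewrite ua in nuv.
  apply: connect_sub => a b /and3P[az bz ab]; apply: connect1.
  apply/and3P; split=> //; first exact: contra (fintype.subsetP sub a) az.
  exact: contra (fintype.subsetP sub b) bz.
have /gconnected_avoid/(_ x y xS yS) := conn S cardS.
apply: connect_sub => a b /and3P[aS bS ab].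
have [E|NE] := eqVneq [set a; b] [set u; v]; last first.
  by apply: connect1; rewrite /avoid /= aS bS /= /del_adj ab.
have sym : connect_sym (@avoid (del_edge u v) S).
  apply: sym_connect_sym => c d; rewrite /avoid /= del_sym.
  by case: (c \in S); case: (d \in S).
have : a \in [set u; v] by rewrite -E !inE eqxx.
have : b \in [set u; v] by rewrite -E !inE eqxx orbT.
rewrite !inE => /orP[]/eqP eb /orP[]/eqP ea; subst.
- by rewrite connect0.
- by rewrite sym uvS.
- by rewrite uvS.
- by rewrite connect0.
Qed.

(** Guarantees order at least 4 once the size is at least 6, as triangle-freeness requires. *)
Lemma gsize_le (G : sgraph) : (gsize G <= 'C(#|G|, 2))%N.
Proof.
rewrite -card_draws; apply/subset_leq_card/fintype.subsetP => e.
case/imsetP => -[x y]; rewrite !inE /= => xy ->.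
by rewrite cards2 (contraTneq _ xy) // => ->; rewrite adj_irr.
Qed.

(** If [u] were the only neighbour of [v], then [{v}] would be closed in [G - u] and miss a third
    vertex. *)
Lemma deg_ge2 (G : sgraph) (v : G) :
  kconnected 2 G -> (2 < #|G|)%N -> (2 <= deg v)%N.
Proof.
move=> conn n3; rewrite leqNgt; apply/negP; rewrite /deg => dv.
have third (S : {set G}) : (#|S| < 3)%N -> exists y, y \notin S.
  move=> cS; have : (0 < #|~: S|)%N by rewrite cardsCs finset.setCK; lia.
  by case/card_gt0P => y; rewrite inE; exists y.
(* For an isolated [v] any other vertex can play the role of [u]. *)
have [u vu sub] : exists2 u, v != u & forall y, v -- y -> y = u.
  have [E|[u]] := set_0Vmem [set y | v -- y].
    have [|u] := third [set v]; first by rewrite cards1.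
    rewrite inE eq_sym; exists u => // y vy.
    by have : y \in [set y | v -- y] by [rewrite inE]; rewrite E inE.
  rewrite inE => vu; exists u; first by apply: contraTneq vu => ->; rewrite adj_irr.
  move=> y vy; apply: contraTeq dv => yu; rewrite -leqNgt.
  rewrite -(_ : #|[set y; u]| = 2%N); last by rewrite cards2 yu.
  by apply/subset_leq_card/fintype.subsetP => a; rewrite !inE => /orP[]/eqP->.
have [|y] := third [set u; v]; first by rewrite cards2; lia.
rewrite !inE negb_or => /andP[yu yv].
have := @kconnected2_closed G u [set v] v y conn.
rewrite !inE eqxx vu yu => /(_ isT isT isT) H.
by rewrite H // in yv => a b; rewrite inE => /eqP-> _ bu /sub E; rewrite E eqxx in bu.
Qed.

(* The separators of [uv] and [ux] are [x] and [v], so the component of [u] in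
   [G - v - x] is attached to the rest of the graph through [u] only. *)
Lemma triangle_nbr (G : sgraph) (u v x y : G) :
  minimally_kconnected 2 G -> (2 < #|G|)%N ->
  u -- v -> v -- x -> x -- u -> u -- y -> y = v \/ y = x.
Proof.
move=> minG n3 uv vx xu uy.
(* The walk [a, c, b] avoids the edge [ab], so the vertex separating [a] from [b] can only be
   [c]. *)
have sep a b c : a -- b -> b -- c -> c -- a -> exists C : {set G},
   [/\ a \in C, b \notin C, c \notin C &
    forall d e, d \in C -> e != c -> d -- e -> (d, e) != (a, b) -> e \in C].
  move=> ab bc ca; have [z [C [[za zb] aC bC zC clC]]] :=
    minimally_2connected_separator minG n3 ab.
  have [<-|cz] := eqVneq z c; first by exists C.
  have cb : c != b by apply: contraTneq bc => ->; rewrite adj_irr.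
  have cC : c \in C.
    apply: (clC a c) => //; rewrite 1?eq_sym 1?adj_sym //.
    by rewrite xpair_eqE negb_and eq_sym cb orbT.
  have : b \in C.
    apply: (clC c b) => //; rewrite 1?eq_sym 1?adj_sym //.
    by rewrite xpair_eqE negb_and (contraTneq _ ca) // => ->; rewrite adj_irr.
  by rewrite (negPf bC).
have ux : u -- x by rewrite adj_sym.
have [A [uA vA xA clA]] := sep _ _ _ uv vx xu.
have [B [uB xB vB clB]] := sep u x v ux (etrans (adj_sym _ _) vx) (etrans (adj_sym _ _) uv).
have vx' : v != x by apply: contraTneq vx => ->; rewrite adj_irr.
have uv' : v != u by apply: contraTneq uv => ->; rewrite adj_irr.
have yu : y != u by apply: contraTneq uy => ->; rewrite adj_irr.
have [-> |yv] := eqVneq y v; first by left.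
have [-> |yx] := eqVneq y x; first by right.
have yA : y \in A by apply: (clA u) => //; rewrite xpair_eqE negb_and yv orbT.
have yB : y \in B by apply: (clB u) => //; rewrite xpair_eqE negb_and yx orbT.
(* [A :&: B] is closed in [G - u]: an edge leaving it towards [x] would put [x] into [B], one
   towards [v] would put [v] into [A]. As it contains [y], it would contain [v]. *)
have : v \in A :&: B.
  apply: (@kconnected2_closed G u (A :&: B) y v) minG.1 _ yu uv' _.
    by rewrite inE yA.
  move=> a b; rewrite !inE => /andP[aA aB] au bu ab.
  have E z : (a, b) != (u, z) by rewrite xpair_eqE negb_and au.
  have bx : b != x.
    by apply/eqP => bx; subst b; case/negP: xB; apply: (clB a); rewrite // eq_sym.
  have bv : b != v.
    by apply/eqP => bv; subst b; case/negP: vA; apply: (clA a); rewrite // eq_sym.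
  by rewrite (clA a) // (clB a).
by rewrite inE (negPf vA).
Qed.

(** By [triangle_nbr] no edge leaves the triangle, so [{u, v}] would be closed in [G - x] and miss a
    fourth vertex. *)
Lemma triangle_free (G : sgraph) (u v x : G) :
  minimally_kconnected 2 G -> (3 < #|G|)%N ->
  u -- v -> v -- x -> x -- u -> False.
Proof.
move=> minG n4 uv vx xu; have n3 := ltnW n4.
have : (0 < #|~: [set u; v; x]|)%N.
  rewrite cardsCs finset.setCK subn_gt0; apply: leq_ltn_trans n4.
  by rewrite -setUA !cardsU1 cards1; do 2 case: (_ \notin _).
case/card_gt0P => y; rewrite !inE !negb_or => /andP[/andP[yu yv] yx].
have ux : u != x by apply: contraTneq xu => ->; rewrite adj_irr.
have : y \in [set u; v].
  apply: (@kconnected2_closed G x [set u; v] u y minG.1) => //.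
    by rewrite !inE eqxx.
  move=> a b; rewrite !inE => /orP[]/eqP-> _ bx ab.
    have [->|E] := triangle_nbr minG n3 uv vx xu ab; first by rewrite eqxx orbT.
    by rewrite E eqxx in bx.
  have [E|->] := triangle_nbr minG n3 vx xu uv ab; last by rewrite eqxx.
  by rewrite E eqxx in bx.
by rewrite !inE (negPf yu) (negPf yv).
Qed.

(** * Counting the edges that meet a neighbourhood *)

Definition nbr_edges (G : sgraph) (v : G) : {set {set G}} :=
  [set [set p.1; p.2] | p : G * G & (v -- p.1) && (p.1 -- p.2)].

(** This is $D(v)$, the entry at [v] of the adjacency matrix applied to the degree vector. *)
Definition nbr_degsum (G : sgraph) (v : G) : nat := (\sum_(u | v -- u) deg u)%N.

Lemma nbr_edges_sub (G : sgraph) (v : G) : nbr_edges v \subset edges G.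
Proof.
apply/fintype.subsetP => e /imsetP[p]; rewrite inE => /andP[_ pp] ->.
by apply/imsetP; exists p; rewrite ?inE.
Qed.

(** Without triangles an edge has at most one end adjacent to [v], so each edge arises from a single
    ordered pair. *)
Lemma card_nbr_edges (G : sgraph) (v : G) :
  (forall x y z : G, x -- y -> y -- z -> z -- x -> False) ->
  #|nbr_edges v| = nbr_degsum v.
Proof.
move=> tfree; rewrite card_in_imset; last first.
  move=> [a b] [c d]; rewrite !inE /= => /andP[va ab] /andP[vc cd] E.
  have : a \in [set c; d] by rewrite -E !inE eqxx.
  have : b \in [set c; d] by rewrite -E !inE eqxx orbT.
  rewrite !inE => /orP[]/eqP eb /orP[]/eqP ea; subst => //.
  - by rewrite adj_irr in ab.
  - by case: (tfree v c d) => //; rewrite adj_sym.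
  - by rewrite adj_irr in ab.
rewrite -sum1_card /nbr_degsum /deg.
under [RHS]eq_bigr do rewrite -sum1_card.
rewrite pair_big_dep /=; apply: eq_bigl => p; by rewrite !inE.
Qed.

(** * Structure of minimally 2-connected graphs *)

Lemma adj_neq (G : sgraph) (x y : G) : x -- y -> x != y.
Proof. by apply: contraTneq => ->; rewrite adj_irr. Qed.

Lemma deg2_nbr (G : sgraph) (u a b y : G) :
  deg u = 2%N -> u -- a -> u -- b -> a != b -> u -- y -> y = a \/ y = b.
Proof.
rewrite /deg => du ua ub ab uy.
have /eqP E : [set a; b] == [set z | u -- z].
  rewrite eqEcard cards2 ab du andbT; apply/fintype.subsetP => z.
  by rewrite !inE => /orP[]/eqP->.
have : y \in [set a; b] by rewrite E inE.
by rewrite !inE => /orP[]/eqP; [left|right].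
Qed.

Lemma other_nbr (G : sgraph) (S : {set G}) (u : G) :
  (#|S| < deg u)%N -> exists2 w, u -- w & w \notin S.
Proof.
move=> cS; have : (0 < #|[set w | u -- w] :\: S|)%N.
  rewrite cardsD subn_gt0; apply: leq_ltn_trans cS.
  exact/subset_leq_card/subsetIr.
by case/card_gt0P => w; rewrite !inE => /andP[wS uw]; exists w.
Qed.

Section MinimallyTwoConnected.
Variable G : sgraph.
Hypothesis minG : minimally_kconnected 2 G.
Hypothesis n4 : (3 < #|G|)%N.

Let n3 : (2 < #|G|)%N := ltnW n4.
Let tfree (x y z : G) : x -- y -> y -- z -> z -- x -> False := triangle_free minG n4.

Lemma nbr_indep (v x y : G) : v -- x -> v -- y -> ~~ (x -- y).
Proof. by move=> vx vy; apply/negP => xy; apply: (tfree vx xy); rewrite adj_sym. Qed.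

Lemma nbr_degsum_le (v : G) : (nbr_degsum v <= gsize G)%N.
Proof. by rewrite -(card_nbr_edges v tfree) subset_leq_card ?nbr_edges_sub. Qed.

Lemma nbr_degsum_ge (v : G) : (2 * deg v <= nbr_degsum v)%N.
Proof.
rewrite /nbr_degsum /deg -sum1dep_card big_distrr /=.
by apply: leq_sum => u _; exact: deg_ge2 minG.1 n3.
Qed.

(** All degrees are at least 2, so equality of the sums forces equality in every term. *)
Lemma deg2_of_degsum (v u : G) : nbr_degsum v = (2 * deg v)%N -> v -- u -> deg u = 2%N.
Proof.
rewrite /nbr_degsum {2}/deg -sum1dep_card big_distrr /= => E vu.
have ge (w : G) : (2 <= deg w)%N := deg_ge2 _ minG.1 n3.
rewrite (bigD1 u) //= [RHS](bigD1 u) //= in E.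
have : (\sum_(i | v -- i && (i != u)) 2 * 1 <= \sum_(i | v -- i && (i != u)) deg i)%N.
  by apply: leq_sum => w _; exact: ge.
by have := ge u; lia.
Qed.

Section Dominating.
Variable v : G.
Hypothesis full : nbr_degsum v = gsize G.

(** Under [full], [nbr_edges v] exhausts the edges. Together with [nbr_indep], the graph is
    bipartite with the neighbourhood of [v] as one side. *)
Lemma edge_meets_nbr (x y : G) : x -- y -> ~~ (v -- x) -> v -- y.
Proof.
move=> xy vx; have : [set x; y] \in nbr_edges v.
  have -> : nbr_edges v = edges G.
    apply/eqP; rewrite eqEcard nbr_edges_sub (card_nbr_edges v tfree) full.
    exact: leqnn.
  by apply/imsetP; exists (x, y); rewrite ?inE.
case/imsetP => -[a b]; rewrite inE /= => /andP[va ab] E.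
have : a \in [set x; y] by rewrite E !inE eqxx.
by rewrite !inE => /orP[]/eqP e; subst a => //; rewrite va in vx.
Qed.

(** The partner [u'] is the vertex [z] separating the ends of [uv]. A neighbour [w] of [u] has all
    its neighbours adjacent to [v]; one other than [u] and [z] would connect [u] to [v] without [z]
    or the edge [uv]. *)
Lemma dominating_partner (u : G) : v -- u -> (3 <= deg u)%N ->
  exists2 u', v -- u' /\ u' != u & forall w, u -- w -> w != v ->
    u' -- w /\ forall y, w -- y -> y = u \/ y = u'.
Proof.
move=> vu du; have uv : u -- v by rewrite adj_sym.
have [z [C [[zu zv] uC vC zC clC]]] := minimally_2connected_separator minG n3 uv.
have step w y : u -- w -> w != v -> w != z -> w -- y -> y != u -> y = z.
  move=> uw wv wz wy yu; apply/eqP; apply: contraNT vC => yz.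
  have vw : ~~ (v -- w) by apply: nbr_indep uv uw.
  have wC : w \in C by apply: (clC u) => //; rewrite xpair_eqE negb_and wv orbT.
  have yC : y \in C.
    by apply: (clC w) => //; rewrite xpair_eqE negb_and eq_sym (adj_neq uw).
  apply: (clC y); rewrite // ?xpair_eqE ?negb_and ?yu // 1?eq_sym //.
  by rewrite adj_sym; exact: edge_meets_nbr wy vw.
have zN w : u -- w -> w != v -> w != z -> w -- z.
  move=> uw wv wz; have [|y wy] := @other_nbr G [set u] w.
    by rewrite cards1; exact: deg_ge2 minG.1 n3.
  by rewrite inE => yu; rewrite -(step w y).
(* Degree at least 3 leaves a neighbour of [u] besides [v] and [z]; through it [z] is seen to be
   adjacent to [v]. *)
have [w0 uw0] : exists2 w0, u -- w0 & w0 \notin [set v; z].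
  by apply: other_nbr; rewrite cards2 eq_sym zv.
rewrite !inE negb_or => /andP[w0v w0z].
have vz : v -- z by apply: edge_meets_nbr (zN _ uw0 w0v w0z) (nbr_indep uv uw0).
exists z => // w uw wv.
have wz : w != z by apply: contraTneq uw => ->; exact: nbr_indep vu vz.
split=> [|y wy]; first by rewrite adj_sym zN.
by have [->|yu] := eqVneq y u; [left|right; exact: (step w)].
Qed.

(** A neighbour [u] of degree at least 3 and its partner [x] would be partners of each other. They
    and the neighbours of [u] would then be closed in [G - v], missing a third neighbour of [v]. *)
Lemma dominating_deg2 (u : G) : (3 <= deg v)%N -> v -- u -> deg u = 2%N.
Proof.
move=> dv vu; apply/eqP; rewrite eqn_leq (deg_ge2 _ minG.1 n3) andbT.
rewrite leqNgt; apply/negP => du; have uv : u -- v by rewrite adj_sym.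
have [x [vx xu] xP] := dominating_partner vu du.
(* Every neighbour of [u], including [v], is a neighbour of [x]. *)
have dx : (3 <= deg x)%N.
  apply: leq_trans du _; apply/subset_leq_card/fintype.subsetP => w.
  rewrite !inE => uw; have [->|wv] := eqVneq w v; first by rewrite adj_sym.
  by case: (xP w uw wv).
have [x' [vx' x'x] x'P] := dominating_partner vx dx.
have [|w uw] := @other_nbr G [set v] u; first by rewrite cards1 ltnW.
rewrite inE => wv; have [xw wP] := xP w uw wv.
(* The common neighbour [w] of [u] and [x] has no neighbours besides [x] and [x'], but [u] is one of
   them. *)
have x'E : x' = u.
  have [_ /(_ u)] := x'P w xw wv; rewrite adj_sym => /(_ uw) [E|-> //].
  by rewrite E eqxx in xu.
subst x'.
have [|y vy] := @other_nbr G [set u; x] v; first by rewrite cards2 eq_sym xu.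
rewrite !inE negb_or => /andP[yu yx].
have : y \in [set a | (a == u) || (a == x) || (u -- a)].
  apply: (@kconnected2_closed G v _ u y minG.1).
  - by rewrite inE eqxx.
  - exact: adj_neq uv.
  - by rewrite eq_sym (adj_neq vy).
  move=> a b; rewrite !inE => /orP[/orP[]|] => [/eqP->|/eqP->|ua] av bv ab.
  - by rewrite ab orbT.
  - by have [-> _] := x'P b ab bv; rewrite orbT.
  - by have [_ /(_ b ab)[->|->]] := xP a ua av; rewrite eqxx ?orbT.
by rewrite inE (negPf yu) (negPf yx) (negPf (nbr_indep vu vy)).
Qed.

(** Let [w] be the other neighbour of some neighbour [u] of [v]. Each neighbour of [w] has degree 2
    and is joined to [v] and [w] only, so [w] and its neighbours are closed in [G - v]. This
    describes $K_{2,d(v)}$ with hubs [v] and [w]. *)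
Lemma dominating_structure : (3 <= deg v)%N ->
  gsize G = (2 * deg v)%N /\
  exists2 w, w != v & forall x, [\/ x = v, x = w | v -- x] /\ (w -- x) = (v -- x).
Proof.
move=> dv; split.
  rewrite -full /nbr_degsum /deg -[X in (2 * X)%N]sum1dep_card big_distrr /=.
  by apply: eq_bigr => u vu; rewrite muln1; exact: dominating_deg2.
have [|u vu _] := @other_nbr G finset.set0 v; first by rewrite cards0; lia.
have uv : u -- v by rewrite adj_sym.
have [|w uw] := @other_nbr G [set v] u; first by rewrite cards1 dominating_deg2.
rewrite inE => wv; exists w => //.
have wu : w -- u by rewrite adj_sym.
have vw : ~~ (v -- w) by exact: nbr_indep uv uw.
have nbr_w a b : w -- a -> a -- b -> b = w \/ b = v.
  move=> wa; have aw : a -- w by rewrite adj_sym.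
  have va : v -- a.
    by apply: edge_meets_nbr wa _.
  have av : a -- v by rewrite adj_sym.
  exact: deg2_nbr (dominating_deg2 dv va) aw av wv.
have V x : x != v -> (x == w) || (w -- x).
  move=> xv; have : x \in [set a | (a == w) || (w -- a)].
    apply: (@kconnected2_closed G v _ w x minG.1) => //; first by rewrite inE eqxx.
    move=> a b; rewrite !inE => /orP[/eqP->|wa] av bv ab; first by rewrite ab orbT.
    have [->|E] := nbr_w a b wa ab; first by rewrite eqxx.
    by rewrite E eqxx in bv.
  by rewrite inE.
move=> x; have [->|xv] := eqVneq x v.
  by split; [constructor 1|rewrite adj_irr adj_sym (negPf vw)].
have [->|xw] := eqVneq x w.
  by split; [constructor 2|rewrite adj_irr (negPf vw)].
have := V x xv; rewrite (negPf xw) /= => wx.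
have vx : v -- x by apply: edge_meets_nbr wx vw.
by split; [constructor 3|rewrite wx vx].
Qed.

End Dominating.

(** Exactly one edge [ab] has no end adjacent to [v]. The graph is $K_{2,d(v)}$ with the hub
    opposite [v] split into the adjacent pair [a], [b]; triangle-freeness assigns each neighbour of
    [v] to only one of them. *)
Lemma almost_dominating_structure (v : G) :
  nbr_degsum v = (2 * deg v)%N -> gsize G = (2 * deg v).+1 ->
  exists a b, [/\ [/\ a -- b, ~~ (v -- a), ~~ (v -- b), a != v & b != v],
    forall x, [\/ x = v, x = a, x = b | v -- x],
    forall x, v -- x -> (a -- x) = ~~ (b -- x) &
    forall x, a -- x || b -- x -> [\/ x = a, x = b | v -- x]].
Proof.
move=> Dv size_G; have d2 := deg2_of_degsum Dv.
have : #|edges G :\: nbr_edges v| = 1%N.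
  rewrite cardsD (setIidPr (nbr_edges_sub v)) (card_nbr_edges v tfree) Dv.
  by rewrite -/(gsize G) size_G subSnn.
move/eqP/cards1P => [e E].
have : e \in edges G :\: nbr_edges v by rewrite E inE.
rewrite inE => /andP[eN /imsetP[[a b]]]; rewrite inE /= => ab e_ab.
have va : ~~ (v -- a).
  by apply: contra eN => va; apply/imsetP; exists (a, b); rewrite ?inE //= va ab.
have vb : ~~ (v -- b).
  apply: contra eN => vb; apply/imsetP; exists (b, a); rewrite ?inE //= ?vb 1?adj_sym //.
  by rewrite finset.setUC.
have unique c d : c -- d -> ~~ (v -- c) -> ~~ (v -- d) -> [set c; d] = [set a; b].
  move=> cd vc vd; rewrite -e_ab; apply/eqP; rewrite -in_set1 -E inE.
  apply/andP; split; last by apply/imsetP; exists (c, d); rewrite ?inE.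
  apply/imsetP => -[[x y]]; rewrite inE /= => /andP[vx xy] Exy.
  have : x \in [set c; d] by rewrite Exy !inE eqxx.
  by rewrite !inE => /orP[]/eqP Ex; rewrite -Ex vx in vc vd.
have av : a != v by apply: contraNneq vb => <-.
have bv : b != v by apply: contraNneq va => <-; rewrite adj_sym.
have side x : a -- x || b -- x -> [\/ x = a, x = b | v -- x].
  have [vx|vx] := boolP (v -- x); first by constructor 3.
  move=> /orP[]cx; have : x \in [set a; b].
  - by rewrite -(unique _ _ cx) // !inE eqxx orbT.
  - by rewrite !inE => /orP[]/eqP->; [constructor 1|constructor 2].
  - by rewrite -(unique _ _ cx) // !inE eqxx orbT.
  - by rewrite !inE => /orP[]/eqP->; [constructor 1|constructor 2].
have V x : [\/ x = v, x = a, x = b | v -- x] /\ (x != v -> [|| x == a, x == b, a -- x | b -- x]).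
  have [->|xv] := eqVneq x v; first by split=> //; constructor 1.
  (* The vertices [a], [b] and their neighbours are closed in [G - v], since neighbours of [v] have
     degree 2. *)
  have : x \in [set c | [|| c == a, c == b, a -- c | b -- c]].
    apply: (@kconnected2_closed G v _ a x minG.1) => //; first by rewrite inE eqxx.
    move=> c d; rewrite !inE => cC cv dv cd.
    have [/eqP ca|ca] := boolP (c == a); first by rewrite -ca cd !orbT.
    have [/eqP cb|cb] := boolP (c == b); first by rewrite -cb cd !orbT.
    rewrite (negPf ca) (negPf cb) /= in cC.
    have vc : v -- c.
      by case: (side c cC) => // E'; rewrite E' eqxx in ca cb.
    have cv' : c -- v by rewrite adj_sym.
    case/orP: cC => cC; rewrite adj_sym in cC.
      have [->|E'] := deg2_nbr (d2 _ vc) cC cv' av cd; first by rewrite eqxx.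
      by rewrite E' eqxx in dv.
    have [->|E'] := deg2_nbr (d2 _ vc) cC cv' bv cd; first by rewrite eqxx orbT.
    by rewrite E' eqxx in dv.
  rewrite inE => xC; split=> //.
  case/or3P: xC => [/eqP->|/eqP->|/side[->|->|vx]];
    by [constructor 2|constructor 3|constructor 4].
exists a; exists b; split=> // [x|x vx].
  by case: (V x).
have xv : x != v by rewrite eq_sym (adj_neq vx).
have [_ /(_ xv)] := V x.
have xa : x != a by apply: contraTneq vx => ->.
have xb : x != b by apply: contraTneq vx => ->.
rewrite (negPf xa) (negPf xb) /=.
have [xa' _|_ /= -> //] := boolP (a -- x).
by apply/esym/negP => xb'; apply: (tfree xa' _ (etrans (adj_sym _ _) ab)); rewrite adj_sym.
Qed.

End MinimallyTwoConnected.

(** * Recognising the extremal graphs *)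

(** The map goes out of the concrete graph [H], where it can be defined by cases; counting vertices
    makes it bijective. *)
Lemma giso_of_inj (G H : sgraph) (g : H -> G) :
  injective g -> (#|G| <= #|H|)%N ->
  (forall x y, (g x -- g y) = (x -- y)) -> giso G H.
Proof.
move=> ginj cardGH gadj; have [f fK gK] := inj_card_bij ginj cardGH.
by exists f; [exists g | move=> x y; rewrite -gadj !gK].
Qed.

Lemma giso_Kbip (G : sgraph) (v w : G) :
  w != v -> (forall x, [\/ x = v, x = w | v -- x] /\ (w -- x) = (v -- x)) ->
  (forall x y, v -- x -> v -- y -> ~~ (x -- y)) ->
  giso G (Kbip 2 (deg v)).
Proof.
move=> wv V indep.
have wvA : w -- v = false by have [_ ->] := V v; rewrite adj_irr.
have wwA : v -- w = false by rewrite adj_sym.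
have nP (i : 'I_(deg v)) : v -- (enum_val i : G) by have := enum_valP i; rewrite inE.
pose g (x : Kbip 2 (deg v)) : G :=
  match x with inl i => if i == ord0 then v else w | inr j => enum_val j end.
apply: (@giso_of_inj _ _ g).
- have lr i j : g (inl i) <> g (inr j).
    move=> /= E; have := nP j; rewrite -E.
    by case: (i == ord0); rewrite ?adj_irr // adj_sym wvA.
  move=> [i|i] [j|j].
  + rewrite /=; case: i => [[|[|i]] hi] //; case: j => [[|[|j]] hj] //= E.
    * by congr inl; apply/val_inj.
    * by rewrite E eqxx in wv.
    * by rewrite E eqxx in wv.
    * by congr inl; apply/val_inj.
  + by move/lr.
  + by move/esym/lr.
  + by move/enum_val_inj ->.
- rewrite [leqRHS]card_sum !card_ord -cardsT.
  have sub : [set: G] \subset v |: (w |: [set y | v -- y]).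
    apply/fintype.subsetP => x _; rewrite !inE.
    by have [[->|->|->] _] := V x; rewrite ?eqxx ?orbT.
  apply: leq_trans (subset_leq_card sub) _; rewrite !cardsU1 -/(deg v).
  by do 2 case: (_ \notin _); rewrite /=; lia.
- have vj i j : g (inl i) -- g (inr j).
    rewrite /g; case: (i == ord0) => //.
    by have [_ ->] := V (enum_val j).
  move=> [i|i] [j|j]; rewrite [RHS]/= ?vj //.
  + by rewrite /=; case: (i == ord0); case: (j == ord0); rewrite ?adj_irr ?wvA ?wwA.
  + by rewrite adj_sym vj.
  + by apply/negbTE; exact: indep (nP i) (nP j).
Qed.

Lemma inl_inr_pair_neq (n : nat) (i : 'I_2) (j : 'I_n.+1) :
  ([set inl i; inr j] != [set inl ord0; inr ord0] :> {set 'I_2 + 'I_n.+1})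
  = ~~ ((i == ord0) && (j == ord0)).
Proof.
congr (~~ _); apply/eqP/andP => [E|[/eqP-> /eqP-> //]].
have : inl i \in [set inl ord0; inr ord0 : 'I_2 + 'I_n.+1] by rewrite -E !inE eqxx.
have : inr j \in [set inl ord0; inr ord0 : 'I_2 + 'I_n.+1].
  by rewrite -E !inE eqxx orbT.
by rewrite !inE /= orbF => /eqP[->] /eqP[->].
Qed.

(** The only neighbours of [a] are [u] and [b]. Hence [u] subdivides the edge [va] of a complete
    bipartite graph with hubs [v], [b] whose other part is [a] and the neighbours of [v] except
    [u]. *)
Lemma giso_SK2 (G : sgraph) (v a b u : G) (t : nat) :
  deg v = t.+1 ->
  [/\ a -- b, ~~ (v -- a), ~~ (v -- b), a != v & b != v] ->
  (forall x, [\/ x = v, x = a, x = b | v -- x]) ->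
  (forall x, v -- x -> (a -- x) = ~~ (b -- x)) ->
  (forall x y, v -- x -> v -- y -> ~~ (x -- y)) ->
  v -- u -> (forall x, v -- x -> (a -- x) = (x == u)) ->
  giso G (SK2 t.+1).
Proof.
move=> dv [ab va vb av bv] V abN indep vu aN.
pose A := [set y | v -- y] :\ u.
have cA : t = #|A|.
  have := cardsD1 u [set y | v -- y]; rewrite -/(deg v) dv inE vu -/A add1n.
  by case.
have AP (j : 'I_t) : let y := enum_val (cast_ord cA j) in (y != u) && (v -- y).
  by have := enum_valP (cast_ord cA j); rewrite !inE.
pose g (x : SK2 t.+1) : G :=
  match x with
  | None => u
  | Some (inl i) => if i == ord0 then v else b
  | Some (inr i) => if unlift ord0 i is Some j then enum_val (cast_ord cA j) else a
  end.
have ua : u -- a by rewrite adj_sym aN.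
have ub : u -- b = false.
  by rewrite adj_sym; apply: negPf; rewrite -abN // aN.
have aA j : a -- enum_val (cast_ord cA j) = false.
  by have /andP[yu vy] := AP j; rewrite aN // (negPf yu).
have bA j : b -- enum_val (cast_ord cA j).
  by have /andP[yu vy] := AP j; apply: negbNE; rewrite -abN // aA.
have adj_lr i j : g (Some (inl i)) -- g (Some (inr j)) = ~~ ((i == ord0) && (j == ord0)).
  rewrite /g; case: unliftP => [k|] ->; last first.
    by rewrite eqxx andbT; case: (i == ord0); rewrite /= ?(negPf va) // adj_sym ab.
  rewrite [lift _ _ == _]eq_sym (negPf (neq_lift _ _)) andbF /=.
  by case: (i == ord0); rewrite // ?bA //; case/andP: (AP k).
have adj_ul i : u -- g (Some (inl i)) = (i == ord0).
  by rewrite /g; case: (i == ord0); rewrite ?ub // adj_sym vu.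
have adj_ur j : u -- g (Some (inr j)) = (j == ord0).
  rewrite /g; case: unliftP => [k|] ->; last by rewrite eqxx ua.
  rewrite eq_sym (negPf (neq_lift _ _)); apply/negbTE/indep => //.
  by case/andP: (AP k).
have adj_rr i j : g (Some (inr i)) -- g (Some (inr j)) = false.
  rewrite /g; case: unliftP => [k|] _; case: unliftP => [l|] _.
  - by apply/negbTE/indep; [case/andP: (AP k)|case/andP: (AP l)].
  - by rewrite adj_sym aA.
  - by rewrite aA.
  - by rewrite adj_irr.
have vb' : v -- b = false by apply/negbTE.
have bv' : b -- v = false by rewrite adj_sym.
have adj_ll i j : g (Some (inl i)) -- g (Some (inl j)) = false.
  by rewrite /g; case: (i == ord0); case: (j == ord0); rewrite ?adj_irr.
have gadj x y : (g x -- g y) = (x -- y).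
  case: x y => [[i|i]|] [[j|j]|].
  - by rewrite adj_ll.
  - by rewrite adj_lr /= /del_adj inl_inr_pair_neq.
  - by rewrite adj_sym adj_ul /= orbF.
  - by rewrite adj_sym adj_lr [RHS]adj_sym /= /del_adj inl_inr_pair_neq.
  - by rewrite adj_rr.
  - by rewrite adj_sym adj_ur.
  - by rewrite adj_ul /= orbF.
  - by rewrite adj_ur.
  - by rewrite adj_irr.
apply: giso_of_inj gadj.
- have va' : v -- a = false by apply/negbTE.
  have vA k : v -- enum_val (cast_ord cA k) by case/andP: (AP k).
  have ul i : u <> g (Some (inl i)).
    move=> E; have := vu; rewrite E /g.
    by case: (i == ord0); rewrite ?adj_irr ?vb'.
  have ur j : u <> g (Some (inr j)).
    rewrite /g; case: unliftP => [k|] _ E; last by rewrite E va' in vu.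
    by case/andP: (AP k); rewrite -E eqxx.
  have lr i j : g (Some (inl i)) <> g (Some (inr j)).
    rewrite /g; case: unliftP => [k|] _; case: (i == ord0) => E.
    - by have := vA k; rewrite -E adj_irr.
    - by have := vA k; rewrite -E vb'.
    - by rewrite E eqxx in av.
    - by rewrite E adj_irr in ab.
  have ll i j : g (Some (inl i)) = g (Some (inl j)) -> i = j.
    have ord2 : (i == ord0) = (j == ord0) -> i = j.
      by case: i j => [[|[|i]] hi] [[|[|j]] hj] // _; apply/val_inj.
    rewrite /g => E; apply: ord2; move: E.
    case: (i == ord0); case: (j == ord0) => // E.
    - by rewrite E eqxx in bv.
    - by rewrite -E eqxx in bv.
  have rr i j : g (Some (inr i)) = g (Some (inr j)) -> i = j.
    rewrite /g; case: unliftP => [k|] ->; case: unliftP => [l|] -> //.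
    - by move=> /enum_val_inj/cast_ord_inj ->.
    - by move=> E; have := vA k; rewrite E va'.
    - by move=> E; have := vA l; rewrite -E va'.
  move=> [[i|i]|] [[j|j]|] //.
  - by move/ll->.
  - by move/lr.
  - by move/esym/ul.
  - by move/esym/lr.
  - by move/rr->.
  - by move/esym/ur.
  - by move/ul.
  - by move/ur.
- have -> : #|SK2 t.+1| = (2 + t.+1).+1 by rewrite card_option card_sum !card_ord.
  rewrite -cardsT.
  have sub : [set: G] \subset v |: (a |: (b |: [set y | v -- y])).
    apply/fintype.subsetP => x _; rewrite !inE.
    by have [->|->|->|->] := V x; rewrite ?eqxx ?orbT.
  apply: leq_trans (subset_leq_card sub) _; rewrite !cardsU1 -/(deg v) dv.
  by do 3 case: (_ \notin _); rewrite /=; lia.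
Qed.

(** * The alpha-index *)

(** The entry at [v] of $A_\alpha x$, with the diagonal term $\alpha d(v) x_v$ spread over the
    neighbours of [v]. *)
Definition alpha_act (R : realType) (alpha : R) (G : sgraph) (x : G -> R) (v : G) : R :=
  \sum_(u | v -- u) (alpha * x v + (1 - alpha) * x u).

(** [eigenvalue] speaks of row vectors; symmetry of adjacency turns the product into a sum over the
    neighbours of one vertex. *)
Lemma mul_Aalpha (R : realType) (alpha : R) (G : sgraph) (y : 'rV[R]_#|G|) (j : 'I_#|G|) :
  (y *m Aalpha alpha G) 0 j =
  alpha_act alpha (fun v => y 0 (enum_rank v)) (enum_val j).
Proof.
rewrite /alpha_act big_split /= sumr_const -mulr_sumr mxE.
transitivity (\sum_i (y 0 i * (alpha * (deg (enum_val j))%:R * (i == j)%:R)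
   + (1 - alpha) * (y 0 i * (enum_val j -- enum_val i)%:R))).
  apply: eq_bigr => i _; rewrite !mxE adj_sym.
  have [->|_] := eqVneq i j; rewrite ?mulr1n ?mulr0n ?mulr1 ?mulr0; ring.
rewrite big_split /= -mulr_sumr; congr (_ + _ * _).
- rewrite (bigD1 j) //= eqxx big1 => [|i /negPf->]; last by rewrite !mulr0.
  rewrite enum_valK addr0 mulr1 /deg cardsE -[RHS]mulr_natr; ring.
- rewrite (reindex (@enum_rank G)) /=; last by apply: onW_bij; exact: enum_rank_bij.
  rewrite [RHS]big_mkcond /=; apply: eq_bigr => u _.
  by rewrite enum_rankK; case: (_ -- _); rewrite ?mulr1 ?mulr0.
Qed.

Lemma eigenvalue_AalphaP (R : realType) (alpha a : R) (G : sgraph) :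
  eigenvalue (Aalpha alpha G) a <->
  exists2 f : G -> R, (forall v, alpha_act alpha f v = a * f v) & exists v, f v != 0.
Proof.
split=> [/eigenvalueP[y yA yN0]|[f fa [v fv]]].
- exists (fun v => y 0 (enum_rank v)) => [v|].
    by have := mul_Aalpha alpha y (enum_rank v); rewrite yA mxE enum_rankK => <-.
  apply: contrapT => H; case/negP: yN0; apply/eqP/rowP => i; rewrite mxE.
  apply/eqP; apply: contrapT => /negP yi; apply: H.
  by exists (enum_val i); rewrite enum_valK.
- apply/eigenvalueP; exists (\row_i f (enum_val i)).
    apply/rowP => j; rewrite mul_Aalpha !mxE -fa /alpha_act.
    by apply: eq_bigr => u _; rewrite !mxE !enum_rankK.
  apply/eqP => /rowP/(_ (enum_rank v)); rewrite !mxE enum_rankK => /eqP.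
  by rewrite (negPf fv).
Qed.

(** Collatz-Wielandt bound: take [v] maximising [|f v| / x v]. There the triangle inequality and
    nonnegative entries give [|a| <= c]. *)
Lemma eigenvalue_Aalpha_le (R : realType) (alpha c a : R) (G : sgraph) (x : G -> R) :
  0 <= alpha <= 1 -> (forall v, 0 < x v) ->
  (forall v, alpha_act alpha x v <= c * x v) ->
  eigenvalue (Aalpha alpha G) a -> a <= c.
Proof.
move=> /andP[a0 a1] x0 xc /eigenvalue_AalphaP[f fa [v0 fv0]].
pose q v := `|f v| / x v.
have [v _ qmax] := Order.TotalTheory.arg_maxP q (erefl (xpredT v0)).
have M0 : 0 < q v.
  apply: lt_le_trans (qmax v0 isT); apply: divr_gt0 => //.
  by rewrite normr_gt0.
have fle u : `|f u| <= q v * x u by rewrite -ler_pdivrMr //; exact: qmax.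
have : `|a| * `|f v| <= q v * (c * x v).
  rewrite -normrM -fa; apply: le_trans (ler_norm_sum _ _ _) _.
  apply: le_trans (_ : _ <= q v * alpha_act alpha x v) _; last first.
    by rewrite ler_pM2l.
  rewrite mulr_sumr; apply: ler_sum => u _.
  apply: le_trans (ler_normD _ _) _; rewrite !normrM (ger0_norm a0).
  rewrite (ger0_norm (_ : 0 <= 1 - alpha)) ?subr_ge0 // mulrDr ![q v * (_ * _)]mulrCA.
  by apply: lerD; apply: ler_wpM2l => //; rewrite subr_ge0.
have -> : `|f v| = q v * x v by rewrite /q divfK ?gt_eqF.
rewrite mulrCA !ler_pM2l //= ler_pM2r // => ac.
exact: le_trans (ler_norm a) ac.
Qed.

Lemma rho_le (R : realType) (alpha c : R) (G : sgraph) (x : G -> R) :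
  0 <= alpha <= 1 -> 0 <= c -> (forall v, 0 < x v) ->
  (forall v, alpha_act alpha x v <= c * x v) -> rho alpha G <= c.
Proof.
move=> a01 c0 x0 xc.
(* An empty spectrum has supremum 0 by convention, whence the assumption [0 <= c]. *)
have [E|/classical_sets.set0P ne] :=
    eqVneq [set a : R | eigenvalue (Aalpha alpha G) a]%classic classical_sets.set0.
  by rewrite /rho E sup0.
by apply: ge_sup => // a /=; exact: eigenvalue_Aalpha_le.
Qed.

(* Positivity of the eigenvector identifies its eigenvalue as the largest one. *)
Lemma rho_eq (R : realType) (alpha r : R) (G : sgraph) (x : G -> R) (v0 : G) :
  0 <= alpha <= 1 -> (forall v, 0 < x v) ->
  (forall v, alpha_act alpha x v = r * x v) -> rho alpha G = r.
Proof.
move=> a01 x0 xr.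
have ub : ubound [set a : R | eigenvalue (Aalpha alpha G) a]%classic r.
  by move=> a /=; apply: (eigenvalue_Aalpha_le a01 x0) => v; rewrite xr.
have ev : eigenvalue (Aalpha alpha G) r.
  by apply/eigenvalue_AalphaP; exists x => //; exists v0; rewrite gt_eqF.
apply/eqP; rewrite eq_le; apply/andP; split.
  by apply: ge_sup => //; exists r.
by apply: ub_le_sup => //; exists r.
Qed.

Lemma giso_sym (G H : sgraph) : giso G H -> giso H G.
Proof.
move=> [f [g fK gK] fadj].
by exists g; [exists f | move=> x y; rewrite -fadj !gK].
Qed.

Lemma rho_giso (R : realType) (alpha : R) (G H : sgraph) :
  giso G H -> rho alpha G = rho alpha H.
Proof.
move=> isoGH; congr sup; apply/classical_sets.seteqP.
have sub (A B : sgraph) a : giso A B ->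
    eigenvalue (Aalpha alpha B) a -> eigenvalue (Aalpha alpha A) a.
  move=> [f bf fadj] /eigenvalue_AalphaP[x xa [v xv]].
  have [g fK gK] := bf.
  apply/eigenvalue_AalphaP; exists (x \o f) => [u|]; last first.
    by exists (g v); rewrite /= gK.
  rewrite -[RHS]xa /alpha_act [RHS](reindex f) /=; last exact: onW_bij.
  by apply: eq_bigl => w; rewrite fadj.
by split=> a /=; apply: sub => //; exact: giso_sym.
Qed.

(** * The threshold *)

Lemma quadratic_root (R : rcfType) (a b K : R) : 0 < K ->
  exists r, [/\ a < r, b < r & (r - a) * (r - b) = K].
Proof.
move=> K0; pose D := (a - b) ^+ 2 + 4 * K.
have D0 : 0 <= D by rewrite addr_ge0 ?sqr_ge0 // mulr_ge0 // ltW.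
pose q := Num.sqrt D; have qq : q ^+ 2 = D by rewrite sqr_sqrtr.
have q0 : 0 <= q by exact: sqrtr_ge0.
have lt_q z : z ^+ 2 < D -> z < q.
  by move=> zD; rewrite ltNge; apply/negP => qz; nra.
have ab : a - b < q by apply: lt_q; rewrite ltrDl mulr_gt0.
have ba : b - a < q by apply: lt_q; rewrite -sqrrN opprB ltrDl mulr_gt0.
exists ((a + b + q) / 2); split; [lra|lra|].
rewrite (_ : _ * _ = (q ^+ 2 - (a - b) ^+ 2) / 4); last by field.
by rewrite qq /D; field.
Qed.

(** Beyond both [a] and [b] the product is strictly increasing, so [B > r] would give a value above
    [K]. *)
Lemma quadratic_root_ge (R : realFieldType) (a b K r B : R) :
  a < r -> b < r -> (r - a) * (r - b) = K -> (B - a) * (B - b) <= K -> B <= r.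
Proof. by move=> ar br <- BK; rewrite leNgt; apply/negP => rB; nra. Qed.

Lemma quadratic_root_gt (R : realFieldType) (a b K r B : R) :
  a < B -> b < B -> (r - a) * (r - b) <= K -> K < (B - a) * (B - b) -> r < B.
Proof. by move=> ar br rK KB; rewrite ltNge; apply/negP => Br; nra. Qed.

(** Here [s] is [1 - alpha]. The left side bounds $\alpha d + (1-\alpha)D/d$ at a vertex of degree 2
    when all degrees are at most [t - 1]. *)
Lemma threshold_deg2 (R : realFieldType) (s t r : R) :
  0 < s -> s <= 1 / 2 -> (1 - s) * t < r -> (1 - s) * 2 < r ->
  (r - (1 - s) * t) * (r - (1 - s) * 2) = (2 * t - 1) * s ^+ 2 ->
  3 <= t -> (1 - s) * 2 + s * (t - 1) <= r.
Proof.
move=> s0 s2 r1 r2 rE t3; apply: (quadratic_root_ge r1 r2 rE); rewrite -subr_ge0.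
rewrite (_ : _ - _ = s * ((t - 1) * (t - 2) - s * (2 * t ^+ 2 - 7 * t + 4))); last by ring.
(* This sign allows replacing the inner [s] by its bound 1/2, which leaves [t / 2] in the
   bracket. *)
have q0 : 0 <= 2 * t ^+ 2 - 7 * t + 4 by nra.
apply: mulr_ge0; first exact: ltW.
have : 0 <= (1 - 2 * s) * (2 * t ^+ 2 - 7 * t + 4) by rewrite mulr_ge0 //; lra.
lra.
Qed.

(** The same quotient for $d = 3$ and $D = 2t$, the lower end of the degree range in
    [threshold_deg]. *)
Lemma threshold_deg3 (R : realFieldType) (s t r : R) :
  0 < s -> s <= 1 / 2 -> (1 - s) * t < r -> (1 - s) * 2 < r ->
  (r - (1 - s) * t) * (r - (1 - s) * 2) = (2 * t - 1) * s ^+ 2 ->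
  4 <= t -> (1 - s) * 3 + s * (2 * t) / 3 <= r.
Proof.
move=> s0 s2 r1 r2 rE t4; apply: (quadratic_root_ge r1 r2 rE); rewrite -subr_ge0.
pose h := 9 * (t - 3) + s * (6 * t ^+ 2 - 42 * t + 54) - s ^+ 2 * (10 * t ^+ 2 - 51 * t + 36).
rewrite (_ : _ - _ = h / 9); last by rewrite /h; field.
apply: divr_ge0 => //; pose u := t - 4; have u0 : 0 <= u by rewrite /u; lra.
have s20 : 0 <= 1 - 2 * s by lra.
have p : 0 <= s * (1 - 2 * s) * (10 * u ^+ 2 + 29 * u).
  apply: mulr_ge0; first by rewrite mulr_ge0 // ltW.
  by rewrite addr_ge0 // mulr_ge0 // sqr_ge0.
(* In terms of [u = t - 4] every summand is nonnegative for [0 < s <= 1/2]. *)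
rewrite (_ : h = 9 * (1 - 2 * s) + 9 * u * (1 - s) + s * u ^+ 2 + s * u / 2 + 8 * s ^+ 2
  + s * (1 - 2 * s) * (10 * u ^+ 2 + 29 * u) / 2); last by rewrite /h /u; field.
have := mulr_ge0 (ltW s0) u0; have := mulr_ge0 (ltW s0) (sqr_ge0 u).
have : 0 <= u * (1 - s) by rewrite mulr_ge0 //; lra.
by have := sqr_ge0 s; lra.
Qed.

(** The upper end $d = t - 1$ of the degree range, again with $D = 2t$. *)
Lemma threshold_degmax (R : realFieldType) (s t r : R) :
  0 < s -> s <= 1 / 2 -> (1 - s) * t < r -> (1 - s) * 2 < r ->
  (r - (1 - s) * t) * (r - (1 - s) * 2) = (2 * t - 1) * s ^+ 2 ->
  4 <= t -> (1 - s) * (t - 1) + s * (2 * t) / (t - 1) <= r.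
Proof.
move=> s0 s2 r1 r2 rE t4; apply: (quadratic_root_ge r1 r2 rE); rewrite -subr_ge0.
(* Chosen so that [2 * t / (t - 1) = 2 + e]. *)
pose e := 2 / (t - 1); have t1 : t - 1 != 0 by rewrite gt_eqF //; lra.
have e0 : 0 < e by rewrite divr_gt0 //; lra.
have e3 : e <= 2 / 3 by rewrite ler_pM2l // lef_pV2 ?posrE; lra.
rewrite (_ : _ - _ = (t - 3) * (1 - 2 * s) ^+ 2
   + s * (s * (t - 2 - 7 * e - e ^+ 2) + 3 * e)); last by rewrite /e; field.
apply: addr_ge0; first by rewrite mulr_ge0 ?sqr_ge0 //; lra.
apply: mulr_ge0; first exact: ltW.
nra.
Qed.

(** The difference of the two sides is convex in [d], so the bounds at [d = 3] and [d = t - 1]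
    suffice. *)
Lemma threshold_deg (R : realFieldType) (s t r d : R) :
  0 < s -> s <= 1 / 2 -> (1 - s) * t < r -> (1 - s) * 2 < r ->
  (r - (1 - s) * t) * (r - (1 - s) * 2) = (2 * t - 1) * s ^+ 2 ->
  4 <= t -> 3 <= d -> d <= t - 1 ->
  (1 - s) * d ^+ 2 + s * (2 * t) <= r * d.
Proof.
move=> s0 s2 r1 r2 rE t4 d3 dt.
have A : (1 - s) * 9 + s * (2 * t) <= 3 * r by have := threshold_deg3 s0 s2 r1 r2 rE t4; lra.
have B : (1 - s) * (t - 1) ^+ 2 + s * (2 * t) <= r * (t - 1).
  have t1 : 0 < t - 1 by lra.
  have := threshold_degmax s0 s2 r1 r2 rE t4; rewrite -(ler_pM2r t1) mulrDl divfK ?gt_eqF //.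
  by rewrite -mulrA.
(* For [t = 4] the range of [d] is the single value 3, and the interpolation below degenerates. *)
have [E|t4'] := eqVneq t 4.
  by have -> : d = 3 by [lra]; lra.
have t0 : 0 < t - 4 by rewrite subr_gt0 lt_neqAle eq_sym t4'.
rewrite -subr_ge0 -(pmulr_rge0 _ t0).
rewrite (_ : (t - 4) * _ = (t - 1 - d) * (3 * r - ((1 - s) * 9 + s * (2 * t)))
  + (d - 3) * (r * (t - 1) - ((1 - s) * (t - 1) ^+ 2 + s * (2 * t)))
  + (1 - s) * ((t - 4) * ((d - 3) * (t - 1 - d)))); last by ring.
have s1 : 0 <= 1 - s by lra.
by rewrite !addr_ge0 // ?mulr_ge0 // ?subr_ge0 // ltW.
Qed.

(** The inequalities select the larger root of the quadratic. *)
Definition is_threshold (R : realType) (alpha : R) (t : nat) (r : R) : Prop :=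
  [/\ alpha * t%:R < r, alpha * 2 < r &
      (r - alpha * t%:R) * (r - alpha * 2) = (2 * t%:R - 1) * (1 - alpha) ^+ 2].

Lemma threshold_exists (R : realType) (alpha : R) (t : nat) :
  alpha < 1 -> (0 < t)%N -> exists r, is_threshold alpha t r.
Proof.
move=> a1 t0; have [|r [r1 r2 rE]] := @quadratic_root R (alpha * t%:R) (alpha * 2)
  ((2 * t%:R - 1) * (1 - alpha) ^+ 2); last by exists r.
have t1 : 1 <= t%:R :> R by rewrite ler1n.
by apply: mulr_gt0; [lra|rewrite exprn_gt0 // subr_gt0].
Qed.

(** * Upper bounds for the non-extremal graphs *)

(** The degree vector is the test vector. At degree 2 the neighbours contribute at most
    [2 * (t - 1)]; at larger degrees the assumed bound [2 * t] is used. *)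
Lemma rho_le_small_deg (R : realType) (alpha r : R) (G : sgraph) (t : nat) :
  2^-1 <= alpha < 1 -> (3 <= t)%N -> is_threshold alpha t r ->
  (forall v : G, (2 <= deg v <= t.-1)%N) ->
  (forall v : G, (3 <= deg v)%N -> (nbr_degsum v <= 2 * t)%N) ->
  rho alpha G <= r.
Proof.
move=> /andP[a12 a1] t3 [r1 r2 rE] dG DG.
have a0 : 0 <= alpha by apply: le_trans a12; rewrite invr_ge0.
have aE : 1 - (1 - alpha) = alpha by ring.
have s0 : 0 < 1 - alpha by rewrite subr_gt0.
have s2 : 1 - alpha <= 1 / 2 by lra.
have r0 : 0 <= r by lra.
have T3 : 3 <= t%:R :> R by rewrite (ler_nat R 3).
apply: (@rho_le R alpha r G (fun v => (deg v)%:R)) => // [|v|v].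
- by rewrite a0 ltW.
- by rewrite ltr0n; case/andP: (dG v) => /ltnW.
have -> : alpha_act alpha (fun u : G => (deg u)%:R) v
    = alpha * (deg v)%:R ^+ 2 + (1 - alpha) * (nbr_degsum v)%:R.
  rewrite /alpha_act big_split /= sumr_const -mulr_sumr natr_sum; congr (_ + _).
  by rewrite -[LHS]mulr_natr -[in X in _ * X]cardsE expr2 mulrA.
case/andP: (dG v); rewrite leq_eqVlt => /orP[/eqP d2 _|d3 dt].
- rewrite -d2.
  have D : (nbr_degsum v)%:R <= 2 * (t%:R - 1) :> R.
    have : (nbr_degsum v <= 2 * t.-1)%N.
      rewrite /nbr_degsum d2 /deg -sum1dep_card big_distrl /=.
      by apply: leq_sum => u _; rewrite mul1n; case/andP: (dG u).
    rewrite -(ler_nat R) natrM -subn1 natrB //; exact: ltnW (ltnW t3).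
  have := threshold_deg2 s0 s2; rewrite aE => /(_ _ _ r1 r2 rE T3) B.
  have := ler_wpM2l (ltW s0) D; lra.
- have t4 : (4 <= t)%N by lia.
  have T4 : 4 <= t%:R :> R by rewrite (ler_nat R 4).
  have D3 : 3 <= (deg v)%:R :> R by rewrite (ler_nat R 3).
  have Dt : (deg v)%:R <= t%:R - 1 :> R.
    by rewrite -(natrB R (ltnW (ltnW t3))) ler_nat subn1.
  have D : (nbr_degsum v)%:R <= 2 * t%:R :> R by rewrite -natrM ler_nat DG.
  have := threshold_deg s0 s2; rewrite aE => /(_ _ _ _ r1 r2 rE T4 D3 Dt).
  have := ler_wpM2l (ltW s0) D; lra.
Qed.

Lemma alpha_act_const2 (R : realType) (alpha y z1 z2 : R) (G : sgraph) (x : G -> R)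
    (v : G) (A : pred G) :
  (forall u, v -- u -> x u = if A u then z1 else z2) -> x v = y ->
  alpha_act alpha x v =
  #|[set u | v -- u & A u]|%:R * (alpha * y + (1 - alpha) * z1)
  + (deg v - #|[set u | v -- u & A u]|)%:R * (alpha * y + (1 - alpha) * z2).
Proof.
move=> xu xv; rewrite /alpha_act (bigID A) /=.
have -> : (deg v - #|[set u | v -- u & A u]|)%N = #|[set u | v -- u & ~~ A u]|.
  have -> : deg v = (#|[set u | v -- u & A u]| + #|[set u | v -- u & ~~ A u]|)%N.
    rewrite /deg -(cardsID [set u | A u] [set u | v -- u]).
    by congr (_ + _)%N; apply: eq_card => u; rewrite !inE // andbC.
  by rewrite addKn.
by congr (_ + _); rewrite mulr_natl -sumr_const; apply: eq_big => [u|u /andP[vu]];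
  rewrite ?inE // => Au; rewrite xv xu // ?Au ?(negPf Au).
Qed.

Lemma alpha_act_but1 (R : realType) (alpha y z1 z2 : R) (G : sgraph) (x : G -> R)
    (v w : G) : v -- w -> x v = y -> x w = z1 ->
  (forall u, v -- u -> u != w -> x u = z2) ->
  alpha_act alpha x v = alpha * y + (1 - alpha) * z1
    + (deg v).-1%:R * (alpha * y + (1 - alpha) * z2).
Proof.
move=> vw xv xw xu; rewrite (@alpha_act_const2 R alpha y z1 z2 G x v (pred1 w)) //.
  rewrite (_ : [set u | _ & _] = [set w]) ?cards1 ?mul1r ?subn1 //.
  apply/setP => u; rewrite !inE; have [->|] := eqVneq u w; rewrite ?vw ?andbF //.
by move=> u vu /=; have [->|/(xu u vu)] := eqVneq u w.
Qed.

(* At [v] and on its neighbourhood the test vector satisfies the eigenvalue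
   equation for [r] exactly. *)
Lemma rho_le_two_hubs (R : realType) (alpha r : R) (G : sgraph) (v a b : G) (t : nat) :
  2^-1 <= alpha < 1 -> (2 <= t)%N -> is_threshold alpha t r -> deg v = t ->
  (forall x, v -- x -> deg x = 2%N) ->
  [/\ a -- b, ~~ (v -- a), ~~ (v -- b), a != v & b != v] ->
  (forall x, [\/ x = v, x = a, x = b | v -- x]) ->
  (forall x, a -- x || b -- x -> [\/ x = a, x = b | v -- x]) ->
  (forall x y, v -- x -> v -- y -> ~~ (x -- y)) ->
  (deg a < t)%N -> (deg b < t)%N -> rho alpha G <= r.
Proof.
move=> /andP[a12 a1] t2 [r1 r2 rE] dv d2 [ab va vb av bv] V side indep da db.
have a0 : 0 <= alpha by apply: le_trans a12; rewrite invr_ge0.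
have s0 : 0 < 1 - alpha by rewrite subr_gt0.
have s2 : 1 - alpha <= alpha by lra.
have T2 : 2 <= t%:R :> R by rewrite (ler_nat R 2).
set T : R := t%:R in r1 rE T2.
(* The value that the equation for [r] forces on a neighbour of [v], whose own neighbours carry [T]
   and [T - 1]. *)
pose be := (1 - alpha) * (2 * T - 1) / (r - alpha * 2).
have rp : 0 < r - alpha * 2 by rewrite subr_gt0.
have beE : be * (r - alpha * 2) = (1 - alpha) * (2 * T - 1).
  by rewrite /be divfK // gt_eqF.
have be0 : 0 < be by rewrite divr_gt0 // mulr_gt0 //; lra.
(* This is the equation at [v]; it agrees with [beE] because [r] is the threshold. *)
have sbe : (1 - alpha) * be = r - alpha * T.
  by apply: (mulIf (lt0r_neq0 rp)); rewrite -mulrA beE rE; ring.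
pose x z : R := if z == v then T else if v -- z then be else T - 1.
have xv : x v = T by rewrite /x eqxx.
have xN z : v -- z -> x z = be.
  by move=> vz; rewrite /x vz eq_sym (negPf (adj_neq vz)).
have xO z : z != v -> ~~ (v -- z) -> x z = T - 1.
  by move=> /negPf zv /negPf vz; rewrite /x zv vz.
have hub c d : c -- d -> c != v -> d != v -> ~~ (v -- c) -> ~~ (v -- d) ->
    (deg c < t)%N -> (forall z, c -- z -> z != d -> v -- z) ->
    alpha_act alpha x c <= r * x c.
  move=> cd cv dv' vc vd dc cN.
  rewrite (@alpha_act_but1 R alpha (T - 1) (T - 1) be G x c d) ?xO // => [|z cz zd]; last first.
    by rewrite xN ?cN.
  have dcT : (deg c).-1%:R + 2 <= T.
    have : ((deg c).-1 + 2 <= t)%N by case: (deg c) dc => [|n]; rewrite ?addn2.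
    by rewrite -(ler_nat R) natrD.
  have n0 : 0 <= (deg c).-1%:R :> R by [].
  move: ((deg c).-1%:R) dcT n0 => p pT p0; rewrite sbe -subr_ge0.
  (* [p] counts the neighbours of [c] other than [d], so [p + 2 <= T]; the term
     [alpha - (1 - alpha)] is nonnegative since [alpha] is at least 1/2. *)
  rewrite (_ : _ - _ = (T - 1 - p) * (r - alpha * T)
    + (T - 1) * (alpha * (T - 2 - p) + (alpha - (1 - alpha)))); last by ring.
  apply: addr_ge0; first by apply: mulr_ge0; lra.
  apply: mulr_ge0; first by lra.
  by apply: addr_ge0; [apply: mulr_ge0|]; lra.
apply: (@rho_le R alpha r G x) => [|||z]; first by rewrite a0 ltW.
- by lra.
- by move=> z; rewrite /x; case: (z == v); case: (v -- z) => //; lra.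
have [zv|zv] := eqVneq z v.
  have [|w vw _] := @other_nbr G finset.set0 v; first by rewrite cards0 dv ltnW.
  rewrite zv (alpha_act_but1 alpha vw xv (xN w vw) (fun u vu _ => xN u vu)).
  have -> : (deg v).-1%:R = T - 1 by rewrite dv -subn1 natrB // ltnW.
  rewrite sbe xv le_eqVlt; apply/orP; left; apply/eqP; ring.
have [vz|vz] := boolP (v -- z).
  have zv' : z -- v by rewrite adj_sym.
  have xzO u : z -- u -> u != v -> x u = T - 1.
    by move=> zu uv; rewrite xO //; apply: contraTN zu; exact: indep.
  by rewrite (alpha_act_but1 alpha zv' (xN z vz) xv xzO) d2 // xN //=; lra.
have ba : b -- a by rewrite adj_sym.
have [zE|zE|zE|zE] := V z.
- by rewrite zE eqxx in zv.
- rewrite zE; apply: (hub a b) => // u au ub.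
  have /side[ua|ub'|//] : a -- u || b -- u by rewrite au.
    by rewrite ua adj_irr in au.
  by rewrite ub' eqxx in ub.
- rewrite zE; apply: (hub b a) => // u bu ua.
  have /side[ua'|ub|//] : a -- u || b -- u by rewrite bu orbT.
    by rewrite ua' eqxx in ua.
  by rewrite ub adj_irr in bu.
- by rewrite zE in vz.
Qed.

(** * The alpha-index of the extremal graphs *)

(** The index [q] has the positive eigenvector with 1 on the hubs and [y] elsewhere. Its quadratic
    has constant [2 * t] in place of [2 * t - 1], so [q] exceeds [r]. *)
Lemma rho_Kbip_gt (R : realType) (alpha r : R) (t : nat) :
  0 <= alpha < 1 -> (0 < t)%N -> is_threshold alpha t r -> r < rho alpha (Kbip 2 t).
Proof.
move=> /andP[a0 a1] t0 [r1 r2 rE].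
have s0 : 0 < 1 - alpha by rewrite subr_gt0.
have T0 : 0 < t%:R :> R by rewrite ltr0n.
have ss0 : 0 < (1 - alpha) ^+ 2 by rewrite exprn_gt0.
have [|q [q1 q2 qE]] := @quadratic_root R (alpha * t%:R) (alpha * 2)
  (2 * t%:R * (1 - alpha) ^+ 2); first by rewrite !mulr_gt0.
have qp : 0 < q - alpha * 2 by rewrite subr_gt0.
pose y := 2 * (1 - alpha) / (q - alpha * 2).
pose x (z : Kbip 2 t) := if z is inl _ then 1 else y.
suff -> : rho alpha (Kbip 2 t) = q.
  by apply: quadratic_root_gt q1 q2 (lexx _) _; rewrite rE qE ltr_pM2r //; lra.
apply: (@rho_eq R alpha q (Kbip 2 t) x (inl ord0)); first by rewrite a0 ltW.
  by case=> i //=; rewrite divr_gt0 // mulr_gt0.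
move=> v; rewrite /alpha_act big_sumType /=.
have yE : y * (q - alpha * 2) = 2 * (1 - alpha) by rewrite /y divfK // gt_eqF.
case: v => i /=.
  rewrite big_pred0_eq /= add0r sumr_const card_ord -mulr_natl mulr1.
  apply: (mulIf (lt0r_neq0 qp)).
  have -> : t%:R * (alpha + (1 - alpha) * y) * (q - alpha * 2) =
    t%:R * (alpha * (q - alpha * 2) + (1 - alpha) * (y * (q - alpha * 2))) by ring.
  by rewrite yE mulr1; lra.
rewrite big_pred0_eq /= addr0 sumr_const card_ord -mulr_natl.
lra.
Qed.

Lemma big_optionE (V : nmodType) (T : finType) (P : pred (option T)) (F : option T -> V) :
  \sum_(x | P x) F x =
  (if P None then F None else 0) + \sum_(x | P (Some x)) F (Some x).
Proof.
rewrite big_mkcond (bigD1 None) //=; congr (_ + _).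
rewrite [RHS]big_mkcond /= (reindex_omap Some id) => [|[x|] //].
by apply: eq_bigl => x; rewrite /= eqxx.
Qed.

(** By symmetry the eigenvector takes three values: 1 on the hubs, [z] on the two adjacent vertices
    of degree 2, [y] on the rest. *)
Lemma rho_SK2 (R : realType) (alpha q : R) (t : nat) :
  0 <= alpha < 1 -> alpha * t.+1%:R < q -> alpha * 2 < q -> alpha + 1 < q ->
  (q - alpha - 1) * ((q - alpha * t.+1%:R) * (q - alpha * 2)
     - (2 * t.+1%:R - 1) * (1 - alpha) ^+ 2) = (1 - alpha) ^+ 3 ->
  rho alpha (SK2 t.+1) = q.
Proof.
move=> /andP[a0 a1] q1 q2 q3 qE.
have s0 : 0 < 1 - alpha by rewrite subr_gt0.
have p2 : 0 < q - alpha * 2 by rewrite subr_gt0.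
have p3 : 0 < q - alpha - 1 by rewrite -addrA -opprD subr_gt0.
pose y := 2 * (1 - alpha) / (q - alpha * 2).
pose z := (1 - alpha) / (q - alpha - 1).
have yE : y * (q - alpha * 2) = 2 * (1 - alpha) by rewrite /y divfK // gt_eqF.
have zE : z * (q - alpha - 1) = 1 - alpha by rewrite /z divfK // gt_eqF.
pose x (w : SK2 t.+1) := match w with
  | None => z
  | Some (inl _) => 1
  | Some (inr j) => if j == ord0 then z else y
  end.
(* The eigenvalue equation at a hub; clearing denominators turns it into [qE]. *)
have hubE : alpha * t.+1%:R + (1 - alpha) * (z + t%:R * y) = q.
  have T1 : t.+1%:R = t%:R + 1 :> R by rewrite -natr1.
  apply: (mulIf (lt0r_neq0 p2)); apply: (mulIf (lt0r_neq0 p3)).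
  have -> : (alpha * t.+1%:R + (1 - alpha) * (z + t%:R * y)) * (q - alpha * 2) * (q - alpha - 1)
    = alpha * t.+1%:R * (q - alpha * 2) * (q - alpha - 1)
      + (1 - alpha) * (z * (q - alpha - 1)) * (q - alpha * 2)
      + (1 - alpha) * t%:R * (y * (q - alpha * 2)) * (q - alpha - 1) by ring.
  rewrite yE zE; rewrite T1 in qE *; apply/eqP; rewrite -subr_eq0; apply/eqP.
  transitivity ((1 - alpha) ^+ 3 - (q - alpha - 1) * ((q - alpha * (t%:R + 1)) * (q - alpha * 2) -
     (2 * (t%:R + 1) - 1) * (1 - alpha) ^+ 2)); last by rewrite qE subrr.
  ring.
have y0 : 0 < y by rewrite divr_gt0 // mulr_gt0.
have z0 : 0 < z by rewrite divr_gt0.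
apply: (@rho_eq R alpha q (SK2 t.+1) x None); first by rewrite a0 ltW.
  by case=> [[i|j]|] //=; case: (j == ord0).
have l0 (j : 'I_t) : (lift ord0 j == ord0) = false by [].
have S F (i : 'I_2) : \sum_(j < t.+1 | ~~ ((i == ord0) && (j == ord0))) F j =
    (if i == ord0 then 0 else F ord0) + \sum_(j < t) F (lift ord0 j) :> R.
  by rewrite big_mkcond big_ord_recl /= andbT; case: (i == ord0); congr (_ + _);
     apply: eq_bigr => j _; rewrite l0 ?andbF.
case=> [[i|j]|]; rewrite /alpha_act big_optionE big_sumType /=.
- rewrite big_pred0 ?add0r //.
  under eq_bigl => j do rewrite /del_adj inl_inr_pair_neq.
  rewrite S orbF; under eq_bigr => j _ do rewrite l0.
  rewrite sumr_const card_ord -mulr_natl -[RHS]mulr1 -hubE -natr1.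
  by case: i => [[|[|i]] hi] //=; ring.
- have e : (inr j == inr ord0 :> 'I_2 + 'I_t.+1) = (j == ord0) by [].
  rewrite e [X in _ + (_ + X)]big_pred0 ?addr0 //.
  under eq_bigl => i do rewrite del_sym /= /del_adj inl_inr_pair_neq.
  rewrite big_mkcond !big_ord_recl big_ord0 /=.
  case: (j == ord0) => /=; last by lra.
  by have -> : q * z = z * (q - alpha - 1) + (alpha + 1) * z by [ring]; rewrite zE; ring.
- rewrite big_mkcond !big_ord_recl big_ord0 /= big_mkcond big_ord_recl big1 //=.
  by have -> : q * z = z * (q - alpha - 1) + (alpha + 1) * z by [ring]; rewrite zE; ring.
Qed.

(** The cubic is negative at [r] and nonnegative at [r + 1], so it has a root [q > r]. [rho_SK2]
    identifies [q] as the index. *)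
Lemma rho_SK2_root (R : realType) (alpha r : R) (t m : nat) :
  2^-1 <= alpha < 1 -> (3 < t)%N -> m = (2 * t).+1 -> is_threshold alpha t r ->
  r < rho alpha (SK2 t) /\
  is_largest_root
   ('X^3
    - ((m%:R + 5) / 2 * alpha + 1) *: 'X^2
    + ((m%:R + 5) / 2 * alpha ^+ 2 + 5 * (m%:R - 1) / 2 * alpha
       + 2 - m%:R) *: 'X
    + (- 2 * m%:R * alpha ^+ 2 - (m%:R - 5) * alpha + m%:R - 3)%:P)
   (rho alpha (SK2 t)).
Proof.
move=> /andP[a12 a1] t3 mE [r1 r2 rE].
have T4 : 4 <= t%:R :> R by rewrite (ler_nat R 4).
have s0 : 0 < 1 - alpha by rewrite subr_gt0.
have mR : m%:R = 2 * t%:R + 1 :> R by rewrite mE -natr1 natrM.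
set p : {poly R} := (X in is_largest_root X _).
have pE x : p.[x] = (x - alpha - 1) * ((x - alpha * t%:R) * (x - alpha * 2)
     - (2 * t%:R - 1) * (1 - alpha) ^+ 2) - (1 - alpha) ^+ 3.
  have cubicE (a b c : R) :
      ('X^3 - a *: 'X^2 + b *: 'X + c%:P).[x] = x ^+ 3 - a * x ^+ 2 + b * x + c.
    by rewrite !hornerE.
  by rewrite /p cubicE mR; field.
have s3 : 0 < (1 - alpha) ^+ 3 by rewrite exprn_gt0.
(* Indeed [r > alpha * t >= 4 * alpha > alpha + 1]. *)
have ra : alpha + 1 < r by nra.
have p_r : p.[r] <= 0 by rewrite pE rE subrr mulr0 sub0r oppr_le0 ltW.
have p_r1 : 0 <= p.[r + 1].
  rewrite pE (_ : _ - (2 * t%:R - 1) * _ = (r - alpha * t%:R) + (r - alpha * 2) + 1); last first.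
    by rewrite -rE; ring.
  have : (1 - alpha) ^+ 3 <= 1 by rewrite exprn_ile1 //; lra.
  nra.
have rr1 : r <= r + 1 by rewrite lerDl.
have p0 : p.[r] <= 0 <= p.[r + 1] by rewrite p_r.
have [q /andP[rq _] pq] := poly_ivt rr1 p0.
have {rq} rq : r < q.
  rewrite lt_neqAle rq andbT; apply: contraTneq pq => <-.
  by rewrite /root pE rE subrr mulr0 sub0r oppr_eq0 gt_eqF.
have -> : rho alpha (SK2 t) = q.
  case: t t3 T4 mE r1 rE mR pE => // t _ _ _ r1 _ _ pE; apply: rho_SK2 => //.
  - by rewrite a1 andbT; lra.
  - exact: lt_trans rq.
  - exact: lt_trans rq.
  - exact: lt_trans rq.
  - by apply/eqP; rewrite -subr_eq0 -pE; exact: pq.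
split=> //; split=> // x px; rewrite leNgt; apply/negP => qx.
have := px; rewrite /root pE; move: pq; rewrite /root pE => /eqP pq.
(* Past [q] both factors of the leading product increase strictly, so no larger root exists. *)
apply/negP; rewrite gt_eqF // -pq ltrD2r.
apply: ltr_pM; rewrite ?subr_ge0 //; try lra.
  by rewrite -rE; nra.
nra.
Qed.

(** * Dichotomy: extremal graph or index at most the threshold *)

(** If no vertex of degree at least 3 attains $D(v) = m$, then $2d(v) \le D(v) < 2t$ at each of
    them, so all degrees are below [t]. *)
Lemma rho_even_cases (R : realType) (alpha r : R) (G : sgraph) (t : nat) :
  minimally_kconnected 2 G -> (3 < #|G|)%N -> 2^-1 <= alpha < 1 -> (3 <= t)%N ->
  gsize G = (2 * t)%N -> is_threshold alpha t r ->
  giso G (Kbip 2 t) \/ rho alpha G <= r.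
Proof.
move=> minG n4 ha t3 size_G thr.
have ge2 (v : G) : (2 <= deg v)%N := deg_ge2 v minG.1 (ltnW n4).
have [/existsP[v /andP[dv /eqP full]]|none] :=
  boolP [exists v : G, (3 <= deg v)%N && (nbr_degsum v == gsize G)].
- have [size_v [w wv V]] := dominating_structure minG n4 full dv.
  have -> : t = deg v by apply/eqP; rewrite -(eqn_pmul2l (m := 2)) // -size_v size_G.
  by left; apply: giso_Kbip wv V (nbr_indep minG n4 (v := v)).
- right; have D (v : G) : (3 <= deg v)%N -> (nbr_degsum v < 2 * t)%N.
    move=> dv; rewrite -size_G ltn_neqAle (nbr_degsum_le minG n4) andbT.
    apply: contra none => E.
    by apply/existsP; exists v; rewrite dv.
  apply: (rho_le_small_deg ha t3 thr) => v; last by move/D/ltnW.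
  rewrite ge2 /=; have := ge2 v; rewrite leq_eqVlt => /orP[/eqP<-|dv].
    by rewrite -ltnS (ltn_predK t3).
  have := leq_ltn_trans (nbr_degsum_ge minG n4 v) (D v dv).
  by rewrite ltn_pmul2l // => dt; rewrite -ltnS (ltn_predK t3).
Qed.

(** Parity excludes $D(v) = m$ at degree at least 3, so degrees are at most [t]. A vertex of degree
    [t] gives adjacent hubs [a], [b]: a hub of degree 2 yields [SK2], otherwise [rho_le_two_hubs]
    applies. *)
Lemma rho_odd_cases (R : realType) (alpha r : R) (G : sgraph) (t : nat) :
  minimally_kconnected 2 G -> (3 < #|G|)%N -> 2^-1 <= alpha < 1 -> (4 <= t)%N ->
  gsize G = (2 * t).+1 -> is_threshold alpha t r ->
  giso G (SK2 t) \/ rho alpha G <= r.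
Proof.
move=> minG n4 ha t4 size_G thr.
have ge2 (v : G) : (2 <= deg v)%N := deg_ge2 v minG.1 (ltnW n4).
have D (v : G) : (3 <= deg v)%N -> (nbr_degsum v <= 2 * t)%N.
  move=> dv; rewrite -ltnS -size_G ltn_neqAle (nbr_degsum_le minG n4) andbT.
  apply/eqP => full; have [] := dominating_structure minG n4 full dv.
  by rewrite size_G => E _; have := congr1 odd E; rewrite /= !mul2n !odd_double.
have dle (v : G) : (deg v <= t)%N.
  have := ge2 v; rewrite leq_eqVlt => /orP[/eqP<-|dv]; first exact: ltnW (ltnW t4).
  by have := leq_trans (nbr_degsum_ge minG n4 v) (D v dv); rewrite leq_pmul2l.
have [/existsP[v /eqP dv]|none] := boolP [exists v : G, deg v == t]; last first.
  right; apply: (rho_le_small_deg ha (ltnW t4) thr _ D) => v.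
  rewrite ge2 /= -ltnS (ltn_predK t4).
  rewrite ltn_neqAle dle andbT; apply: contra none => E.
  by apply/existsP; exists v.
have Dv : nbr_degsum v = (2 * deg v)%N.
  apply/eqP; rewrite eqn_leq (nbr_degsum_ge minG n4) andbT dv.
  by apply: D; rewrite dv ltnW.
have size_v : gsize G = (2 * deg v).+1 by rewrite dv.
have [a [b [hub V abN side]]] := almost_dominating_structure minG n4 Dv size_v.
have indep := nbr_indep minG n4 (v := v).
have d2 := deg2_of_degsum minG n4 Dv.
have [ab va vb av bv] := hub.
(* A hub of degree 2 has, besides the other hub, one neighbour [u]: the subdividing vertex. *)
have thin c d : c -- d -> ~~ (v -- d) -> deg c = 2%N ->
    (forall x, c -- x -> [\/ x = c, x = d | v -- x]) ->
    exists2 u, v -- u & forall x, v -- x -> (c -- x) = (x == u).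
  move=> cd vd dc cN; have [|u cu] := @other_nbr G [set d] c; first by rewrite cards1 dc.
  rewrite inE => ud; exists u.
    case: (cN u cu) => // E; first by rewrite E adj_irr in cu.
    by rewrite E eqxx in ud.
  move=> x vx; apply/idP/eqP => [cx|-> //].
  have [//|E] := deg2_nbr dc cu cd ud cx.
  by rewrite -E vx in vd.
have [da|da] := eqVneq (deg a) 2%N.
  have [|u vu aN] := thin a b ab vb da.
    by move=> x ax; apply: side; rewrite ax.
  left; move: dv; case: t {thr D dle size_G} t4 => // t _ dv.
  exact: giso_SK2 dv hub V abN indep vu aN.
have ba : b -- a by rewrite adj_sym.
have [db|db] := eqVneq (deg b) 2%N.
  have [|u vu bN] := thin b a ba va db.
    move=> x bx; have /side[->|->|vx] : a -- x || b -- x by rewrite bx orbT.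
    - by constructor 2.
    - by constructor 1.
    - by constructor 3.
  left; move: dv; case: t {thr D dle size_G} t4 => // t _ dv.
  apply: (@giso_SK2 G v b a u t dv _ _ _ indep vu bN) => // [x|x vx].
    by have [->|->|->|vx] := V x; [constructor 1|constructor 3|constructor 2|constructor 4].
  by rewrite abN // negbK.
(* The [t] neighbours of [v] are divided between [a] and [b], and the edge [ab] adds one to each
   degree. *)
have sum_ab : (deg a + deg b <= t + 2)%N.
  have da' : (deg a <= 1 + #|[set x | v -- x] :&: [set x | a -- x]|)%N.
    apply: (@leq_trans #|b |: ([set x | v -- x] :&: [set x | a -- x])|).
      apply/subset_leq_card/fintype.subsetP => x; rewrite !inE => ax.
      have /side[E|->|->] : a -- x || b -- x by rewrite ax.
      - by rewrite E adj_irr in ax.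
      - by rewrite eqxx.
      - by rewrite ax orbT.
    by rewrite cardsU1 leq_add2r leq_b1.
  have db' : (deg b <= 1 + #|[set x | v -- x] :\: [set x | a -- x]|)%N.
    apply: (@leq_trans #|a |: ([set x | v -- x] :\: [set x | a -- x])|).
      apply/subset_leq_card/fintype.subsetP => x; rewrite !inE => bx.
      have /side[->|E|vx] : a -- x || b -- x by rewrite bx orbT.
      - by rewrite eqxx.
      - by rewrite E adj_irr in bx.
      - by rewrite abN // bx vx orbT.
    by rewrite cardsU1 leq_add2r leq_b1.
  apply: leq_trans (leq_add da' db') _.
  by rewrite addnACA cardsID -/(deg v) dv addnC.
have a3 : (2 < deg a)%N by rewrite ltn_neqAle eq_sym da ge2.
have b3 : (2 < deg b)%N by rewrite ltn_neqAle eq_sym db ge2.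
(* Both hub degrees are at least 3 and their sum is at most [t + 2], so each is below [t]. *)
right; apply: (rho_le_two_hubs ha _ thr dv d2 hub V side indep).
- exact: ltnW (ltnW t4).
- by clear -sum_ab b3; lia.
- by clear -sum_ab a3; lia.
Qed.

Theorem theorem1p4 (R : realType) (G : sgraph) (m : nat) (alpha : R)
    (hG : minimally_kconnected 2 G) (hm : gsize G = m)
    (halpha : 2^-1 <= alpha < 1) :
  ((6 <= m)%N -> ~~ odd m ->
     rho alpha G <= rho alpha (Kbip 2 (m %/ 2)) /\
     (rho alpha G = rho alpha (Kbip 2 (m %/ 2)) <-> giso G (Kbip 2 (m %/ 2))))
  /\
  ((9 <= m)%N -> odd m ->
     [/\ rho alpha G <= rho alpha (SK2 ((m - 1) %/ 2)),
         is_largest_root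
           ('X^3
            - ((m%:R + 5) / 2 * alpha + 1) *: 'X^2
            + ((m%:R + 5) / 2 * alpha ^+ 2 + 5 * (m%:R - 1) / 2 * alpha
               + 2 - m%:R) *: 'X
            + (- 2 * m%:R * alpha ^+ 2 - (m%:R - 5) * alpha + m%:R - 3)%:P)
           (rho alpha (SK2 ((m - 1) %/ 2)))
       & rho alpha G = rho alpha (SK2 ((m - 1) %/ 2)) <->
         giso G (SK2 ((m - 1) %/ 2))]).
Proof.
have n4 : (6 <= m)%N -> (3 < #|G|)%N.
  move=> m6; rewrite ltnNge; apply/negP => n3.
  have : (6 <= 'C(3, 2))%N.
    apply: leq_trans m6 _; rewrite -hm; apply: leq_trans (gsize_le G) _.
    exact: leq_bin2l.
  by [].
have a01 : 0 <= alpha < 1.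
  by case/andP: halpha => a12 ->; rewrite andbT (le_trans _ a12) // invr_ge0.
have a1 : alpha < 1 by case/andP: a01.
split=> [m6 ev|m9 od].
- have mE : m = (2 * (m %/ 2))%N by rewrite mulnC divnK // dvdn2.
  set t := (m %/ 2)%N in mE *.
  have t3 : (3 <= t)%N by rewrite -(leq_pmul2l (m := 2)) // -mE.
  have [r thr] := threshold_exists a1 (ltnW (ltnW t3)).
  have rK := rho_Kbip_gt a01 (ltnW (ltnW t3)) thr.
  have size_G : gsize G = (2 * t)%N by rewrite hm.
  (* Outside the isomorphic case [rho alpha G <= r] lies strictly below the extremal index, which
     settles the bound and the equality case together. *)
  have [iso|Gr] := rho_even_cases hG (n4 m6) halpha t3 size_G thr.
    by rewrite (rho_giso alpha iso).
  have lt := le_lt_trans Gr rK.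
  by split; [exact: ltW | split=> [E|/(rho_giso alpha) E]; rewrite E ltxx in lt].
- have mE : m = (2 * ((m - 1) %/ 2)).+1.
    case: m od {hm n4 m9} => // n /= ev.
    by rewrite subn1 /= mulnC divnK // dvdn2.
  set t := ((m - 1) %/ 2)%N in mE *.
  have t4 : (4 <= t)%N by rewrite -(leq_pmul2l (m := 2)) // -ltnS -mE.
  have [r thr] := threshold_exists a1 (ltn_trans (ltn0Sn _) t4).
  have [rK root_K] := rho_SK2_root halpha t4 mE thr.
  have size_G : gsize G = (2 * t).+1 by rewrite hm.
  have m6 : (6 <= m)%N by apply: leq_trans m9.
  have [iso|Gr] := rho_odd_cases hG (n4 m6) halpha t4 size_G thr.
    by rewrite (rho_giso alpha iso).
  have lt := le_lt_trans Gr rK.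
  by split=> //; [exact: ltW | split=> [E|/(rho_giso alpha) E]; rewrite E ltxx in lt].
Qed.
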